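(* Assume the axiom of continuity for straight lines. Call the elements of $(K_1\times K_1)/{=_{K_1}}$ ratios. Then: (a) For every kind of magnitude $\mathbf{K}$ with universe $K$ and all $v,w\in K$, the supremum $$\mathrm{Ratio}(v,w)=\sup\bigl\{\langle is,js\rangle/{=_{K_1}} : i,j\text{ positive natural numbers and }\langle is,js\rangle<_E\langle v,w\rangle\bigr\},$$ taken in $(K_1\times K_1)/{=_{K_1}}$ ordered by $<''_{K_1}$, exists (here $s$ is any element of $K_1$). (b) For every kind $\mathbf{K}$ with universe $K$ and all $v,w\in K$ there are $r,t\in K_1$ such that $\langle v,w\rangle=_E\langle r,t\rangle$; that is, $\mathbf{K_1}$ is universal. (c) For all kinds $\mathbf{K},\mathbf{K'}$ with universes $K,K'$, all $v,w\in K$ and all $v',w'\in K'$: $\langle v,w\rangle=_E\langle v',w'\rangle$ if and only if $\mathrm{Ratio}(v,w)=\mathrm{Ratio}(v',w')$.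
   Context: A kind of magnitude (a kind) is a structure $\mathbf{K}=\langle K,+,<,\dot{-}\rangle$ with $+$ a binary operation, $<$ a binary relation and $\dot{-}$ a ternary relation on $K$ such that: (i) $\langle K,+\rangle$ is a commutative semigroup; (ii) $x<y$ iff there is $z\in K$ with $y=x+z$; (iii) $<$ is irreflexive and trichotomous; (iv) $\dot{-}(x,y,z)$ holds iff $x=y+z$; (v) $<$ is Archimedean: for all $x,y\in K$ there is a positive integer $n$ with $nx>y$. Here $1x=x$ and $(n+1)x=nx+x$. The converse of $<$ is $>$. $\mathbf{K_1}$, with universe $K_1$, is the kind of straight line-segments of Euclidean geometry (with the Archimedean principle assumed): $K_1$ is the set of all congruence classes of (non-degenerate) straight line-segments, $+$ is the addition induced by laying segments end to end, and $<,\dot{-}$ are determined by $+$ as in (ii) and (iv). Two magnitudes are of the same kind if they belong to the universe of the same kind. For $x_1,x_2$ of the same kind and $x_3,x_4$ of the same kind (possibly different from that of $x_1,x_2$): - $\langle x_1,x_2\rangle =_E\langle x_3,x_4\rangle$ iff for all positive integers $m,n$: $mx_1>nx_2$ iff $mx_3>nx_4$, and $mx_1=nx_2$ iff $mx_3=nx_4$, and $mx_1<nx_2$ iff $mx_3<nx_4$. This is an equivalence relation. - $\langle x_1,x_2\rangle >_E\langle x_3,x_4\rangle$ (equivalently $\langle x_3,x_4\rangle <_E\langle x_1,x_2\rangle$) iff there are positive integers $m,n$ such that $mx_1>nx_2$ and $mx_3\le nx_4$. $=_{K_1}$ is the restriction of $=_E$ to $K_1\times K_1$, and $\langle a,b\rangle/{=_{K_1}}$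 denotes the equivalence class of $\langle a,b\rangle\in K_1\times K_1$. $<''_{K_1}$ is the strict total order induced by $<_E$ on $(K_1\times K_1)/{=_{K_1}}$: $\langle a,b\rangle/{=_{K_1}}<''_{K_1}\langle c,d\rangle/{=_{K_1}}$ iff $\langle a,b\rangle<_E\langle c,d\rangle$. For positive natural numbers $i,j$ the class $\langle is,js\rangle/{=_{K_1}}$ does not depend on $s\in K_1$. A kind $\mathbf{U}$ with universe $U$ is universal if for every kind $\mathbf{K'}$ with universe $K'$ and all $x',y'\in K'$ there are $x,y\in U$ with $\langle x',y'\rangle=_E\langle x,y\rangle$. Axiom of continuity (Dedekind) for straight lines: for distinct points $z,u$, let $L(z,u)$ be the straight line through them with the strict total order $<_{z,u}$ on its points given by betweenness, oriented so that $z<_{z,u}u$; every cut of $L(z,u)$ (partition into two nonempty sets $A,B$ with every point of $A$ preceding every point of $B$) is produced by exactly one point, i.e. either $A$ has a greatest or $B$ has a least point. *)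

(* Defs.v *)
From HB Require Import structures.
From mathcomp Require Import all_boot.
From mathcomp Require Import boolp classical_sets.

Set Implicit Arguments.
Unset Strict Implicit.
Unset Printing Implicit Defensive.

Local Open Scope classical_set_scope.

(** * Equivalence classes *)

Definition quot (T : Type) (R : T -> T -> Prop) : Type :=
  {A : set T | exists x, A = [set y | R x y]}.

Definition class (T : Type) (R : T -> T -> Prop) (x : T) : quot R :=
  exist _ [set y | R x y] (ex_intro _ x erefl).

HB.instance Definition _ (T : Type) (R : T -> T -> Prop) :=
  gen_eqMixin (quot R).
HB.instance Definition _ (T : Type) (R : T -> T -> Prop) :=
  gen_choiceMixin (quot R).

Lemma class_eqP (T : Type) (R : T -> T -> Prop)
    (Rxx : forall x, R x x) (Rsym : forall x y, R x y -> R y x)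
    (Rtrans : forall x y z, R x y -> R y z -> R x z) (x y : T) :
  class R x = class R y <-> R x y.
Proof.
split=> [/(congr1 (@proj1_sig _ _)) /= e|xy].
  have : [set z | R y z] y by exact: Rxx.
  by rewrite -e.
apply: eq_exist; apply/seteqP; split=> z /=.
  by apply: Rtrans; apply: Rsym.
exact: Rtrans.
Qed.

Lemma quotP (T : Type) (R : T -> T -> Prop) (X : quot R) :
  exists x, X = class R x.
Proof. by case: X => A [x e]; exists x; apply: eq_exist. Qed.

(** * Kinds of magnitude *)

(* [multiple add n x] is x + ... + x with n summands; it is only meaningful,
   and only used, for n > 0. *)
Definition multiple (T : Type) (add : T -> T -> T) (n : nat) (x : T) : T :=
  iter n.-1 (fun y => add y x) x.

(* In [kind_trichotomy], mutual exclusiveness of the three cases follows from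
   [kind_lt_irrefl], [kind_ltE] and associativity. *)
Record kind := Kind {
  kind_sort :> Type;
  kind_add : kind_sort -> kind_sort -> kind_sort;
  kind_lt : kind_sort -> kind_sort -> Prop;
  kind_minus : kind_sort -> kind_sort -> kind_sort -> Prop;
  kind_addA : associative kind_add;
  kind_addC : commutative kind_add;
  kind_ltE : forall x y, kind_lt x y <-> exists z, y = kind_add x z;
  kind_lt_irrefl : forall x, ~ kind_lt x x;
  kind_trichotomy : forall x y, [\/ kind_lt x y, x = y | kind_lt y x];
  kind_minusE : forall x y z, kind_minus x y z <-> x = kind_add y z;
  kind_archimedean : forall x y,
    exists n, (0 < n)%N /\ kind_lt y (multiple kind_add n x)
}.

Definition nmul (K : kind) (n : nat) (x : K) : K := multiple (@kind_add K) n x.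

Definition kind_gt (K : kind) (x y : K) : Prop := kind_lt y x.

Definition kind_le (K : kind) (x y : K) : Prop := kind_lt x y \/ x = y.

(** * Comparison of ratios, possibly across kinds *)

Definition eqE (K K' : kind) (p : K * K) (q : K' * K') : Prop :=
  forall m n : nat, (0 < m)%N -> (0 < n)%N ->
  [/\ kind_gt (nmul m p.1) (nmul n p.2) <-> kind_gt (nmul m q.1) (nmul n q.2),
      nmul m p.1 = nmul n p.2 <-> nmul m q.1 = nmul n q.2 &
      kind_lt (nmul m p.1) (nmul n p.2) <-> kind_lt (nmul m q.1) (nmul n q.2)].

Definition gtE (K K' : kind) (p : K * K) (q : K' * K') : Prop :=
  exists m n : nat,
  [/\ (0 < m)%N, (0 < n)%N,
      kind_gt (nmul m p.1) (nmul n p.2) & kind_le (nmul m q.1) (nmul n q.2)].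

Definition ltE (K K' : kind) (p : K * K) (q : K' * K') : Prop := gtE q p.

Lemma eqE_refl (K : kind) (p : K * K) : eqE p p.
Proof. by []. Qed.

Lemma eqE_sym (K K' : kind) (p : K * K) (q : K' * K') : eqE p q -> eqE q p.
Proof.
move=> pq m n m0 n0; have [h1 h2 h3] := pq m n m0 n0.
by split; apply: iff_sym.
Qed.

Lemma eqE_trans (K K' K'' : kind) (p : K * K) (q : K' * K') (r : K'' * K'') :
  eqE p q -> eqE q r -> eqE p r.
Proof.
move=> pq qr m n m0 n0.
have [h1 h2 h3] := pq m n m0 n0; have [k1 k2 k3] := qr m n m0 n0.
by split; [apply: iff_trans h1 k1|apply: iff_trans h2 k2|apply: iff_trans h3 k3].
Qed.

Lemma ltE_eqE (K1 K2 K3 K4 : kind) (p : K1 * K1) (p' : K2 * K2)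
    (q : K3 * K3) (q' : K4 * K4) :
  eqE p p' -> eqE q q' -> ltE p q -> ltE p' q'.
Proof.
move=> pp qq [m [n [m0 n0 gt le]]]; exists m, n.
have [_ p2 p3] := pp m n m0 n0; have [q1 _ _] := qq m n m0 n0.
by split=> //; [apply/q1|case: le => [/p3|/p2]; [left|right]].
Qed.

Definition universal (U : kind) : Prop :=
  forall (K : kind) (x' y' : K), exists x y : U, eqE (x', y') (x, y).

(** * Classes of ratios in a fixed kind *)

Definition ratio (U : kind) : Type := quot (@eqE U U).

Definition ratio_class (U : kind) (p : U * U) : ratio U := class (@eqE U U) p.

Definition ratio_lt (U : kind) (X Y : ratio U) : Prop :=
  exists p q, [/\ X = ratio_class p, Y = ratio_class q & ltE p q].

Lemma ratio_class_eqP (U : kind) (p q : U * U) :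
  ratio_class p = ratio_class q <-> eqE p q.
Proof.
apply: class_eqP => [x|x y|x y z]; first exact: eqE_refl.
- exact: eqE_sym.
- exact: eqE_trans.
Qed.

Lemma ratio_lt_classP (U : kind) (p q : U * U) :
  ratio_lt (ratio_class p) (ratio_class q) <-> ltE p q.
Proof.
split=> [[p' [q' [/ratio_class_eqP pp /ratio_class_eqP qq]]]|pq].
  by apply: ltE_eqE; apply: eqE_sym.
by exists p, q.
Qed.

Definition ratio_le (U : kind) (X Y : ratio U) : Prop := ratio_lt X Y \/ X = Y.

Definition is_sup (U : kind) (S : set (ratio U)) (X : ratio U) : Prop :=
  (forall Y, S Y -> ratio_le Y X) /\
  (forall Z, (forall Y, S Y -> ratio_le Y Z) -> ratio_le X Z).

Definition rationals_below (U : kind) (s : U) (K : kind) (v w : K) :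
    set (ratio U) :=
  [set X | exists i j : nat, [/\ (0 < i)%N, (0 < j)%N,
     ltE (nmul i s, nmul j s) (v, w) & X = ratio_class (nmul i s, nmul j s)]].

(* The default value (s, s)/= is only used if the supremum does not exist. *)
Definition Ratio (U : kind) (s : U) (K : kind) (v w : K) : ratio U :=
  xget (ratio_class (s, s)) (is_sup (rationals_below s v w)).

(** * Euclidean geometry *)

(* Tarski's axioms (in the form of "What is elementary geometry?", 1959), with
   the first-order continuity schema replaced by the Archimedean axiom.
   [bet x y z]: y lies between x and z, endpoints included.
   [cong x y z u]: x is as distant from y as z is from u.
   There is no upper dimension axiom, so that the Euclidean plane and Euclidean
   space are both covered. *)
Record euclidean_geometry := EuclideanGeometry {
  point :> Type;
  bet : point -> point -> point -> Prop;
  cong : point -> point -> point -> point -> Prop;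
  bet_identity : forall x y, bet x y x -> x = y;
  bet_trans : forall x y z u, bet x y u -> bet y z u -> bet x y z;
  bet_connect : forall x y z u, bet x y z -> bet x y u -> x <> y ->
    bet x z u \/ bet x u z;
  cong_swap : forall x y, cong x y y x;
  cong_identity : forall x y z, cong x y z z -> x = y;
  cong_inner_trans : forall x y z u v w,
    cong x y z u -> cong x y v w -> cong z u v w;
  pasch : forall t x y z u, bet x t u -> bet y u z ->
    exists v, bet x v y /\ bet z t v;
  euclid : forall t x y z u, bet x u t -> bet y u z -> x <> u ->
    exists v w, [/\ bet x z v, bet x y w & bet v t w];
  five_segment : forall x x' y y' z z' u u',
    cong x y x' y' -> cong y z y' z' -> cong x u x' u' -> cong y u y' u' ->
    bet x y z -> bet x' y' z' -> x <> y -> cong z u z' u';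
  segment_construction : forall x y u v, exists z, bet x y z /\ cong y z u v;
  lower_dim : exists x y z, [/\ ~ bet x y z, ~ bet y z x & ~ bet z x y];
  (* Laying off copies of cd from a along the ray ab passes beyond b. *)
  archimedean : forall a b c d, a <> b -> c <> d ->
    exists (n : nat) (p : nat -> point),
    [/\ (0 < n)%N, p 0 = a,
        (forall i, (i < n)%N -> cong (p i) (p i.+1) c d),
        (forall i, (i.+1 < n)%N -> bet (p i) (p i.+1) (p i.+2)) &
        bet a b (p n) /\ b <> p n]
}.

(** ** The axiom of continuity for straight lines *)

Section Continuity.
Variable E : euclidean_geometry.
Implicit Types (z u x y : E).

Definition line z u : set E :=
  [set x | [\/ bet z u x, bet u x z | bet x z u]].

(* In the direction from a to b, the points x, y of the segment ab are met in
   this order (x = y is allowed). *)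
Definition ordered_between a x y b : Prop := @bet E a x y /\ bet a y b.

(* The order of L(z,u) with z before u: x precedes y iff some segment ab
   contains z, u, x, y and, going from a to b, z comes before u and x before
   y. *)
Definition line_lt z u x y : Prop :=
  x <> y /\ exists a b, ordered_between a z u b /\ ordered_between a x y b.

Definition line_cut z u (A B : set E) : Prop :=
  [/\ A !=set0, B !=set0, A `|` B = line z u, A `&` B = set0 &
      forall x y, A x -> B y -> line_lt z u x y].

Definition line_greatest z u (A : set E) x : Prop :=
  A x /\ forall y, A y -> y = x \/ line_lt z u y x.

Definition line_least z u (B : set E) x : Prop :=
  B x /\ forall y, B y -> x = y \/ line_lt z u x y.

Definition continuity_axiom : Prop :=
  forall z u, z <> u -> forall A B : set E, line_cut z u A B ->
  (exists x, line_greatest z u A x) \/ (exists x, line_least z u B x).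

End Continuity.

(** ** Elementary consequences of the axioms *)

Section Geometry.
Variable E : euclidean_geometry.
Implicit Types (a b c d e f x y z : E).

Lemma cong_refl a b : @cong E a b a b.
Proof. by apply: (@cong_inner_trans E b a); apply: cong_swap. Qed.

Lemma cong_sym a b c d : @cong E a b c d -> cong c d a b.
Proof. by move=> h; apply: (cong_inner_trans h); apply: cong_refl. Qed.

Lemma cong_trans a b c d e f :
  @cong E a b c d -> cong c d e f -> cong a b e f.
Proof. by move=> /cong_sym h; apply: cong_inner_trans. Qed.

Lemma congC a b c d : @cong E a b c d -> cong b a d c.
Proof.
move=> h; apply: cong_trans (cong_swap b a) _.
by apply: cong_trans h (cong_swap c d).
Qed.

Lemma congCr a b c d : @cong E a b c d -> cong a b d c.
Proof. by move=> h; apply: cong_trans h (cong_swap c d). Qed.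

Lemma cong_trivial a b : @cong E a a b b.
Proof.
have [z [_ h]] := segment_construction a a b b.
by have az := cong_identity h; rewrite -az in h.
Qed.

Lemma bet_refl a b : @bet E a b b.
Proof.
have [z [h h']] := segment_construction a b b b.
by rewrite -(cong_identity h') in h.
Qed.

Lemma bet_sym a b c : @bet E a b c -> bet c b a.
Proof.
move=> abc; have [v [h h']] := pasch abc (bet_refl a c).
by rewrite -(bet_identity h) in h'.
Qed.

Lemma construction_uniq a b x y : a <> b ->
  @bet E a b x -> bet a b y -> cong b x b y -> x = y.
Proof.
move=> ab abx aby bxy.
apply: (@cong_identity E _ _ y).
exact: (five_segment (cong_refl a b) bxy (cong_refl a y) (cong_refl b y)).
Qed.

Lemma cong_add a b c a' b' c' : @bet E a b c -> bet a' b' c' ->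
  cong a b a' b' -> cong b c b' c' -> cong a c a' c'.
Proof.
move=> abc abc' h k; have [ab|ab] := pselect (a = b).
  rewrite ab in h *; have -> : a' = b' by exact: cong_identity (cong_sym h).
  exact: k.
apply: congC; apply: (five_segment h k) => //; first exact: cong_trivial.
exact: congC.
Qed.

Lemma bet_outer a b c d : b <> c -> @bet E a b c -> bet b c d ->
  bet a c d.
Proof.
move=> bc abc bcd; have [x [acx cx]] := segment_construction a c c d.
have bcx : bet b c x.
  by apply: bet_sym; apply: bet_trans (bet_sym acx) (bet_sym abc).
by rewrite -(construction_uniq bc bcx bcd cx).
Qed.

Lemma bet_lt_ncong a b c : @bet E a b c -> cong a b a c -> b = c.
Proof.
move=> abc h; have [ca|ca] := pselect (c = a).
  by rewrite ca in abc *; rewrite (bet_identity abc).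
have [e [cae ae]] := segment_construction c a c a.
have ea : e <> a.
  by move=> ea; rewrite ea in ae; exact/ca/(cong_identity (cong_sym ae)).
have eac := bet_sym cae.
by apply: (construction_uniq ea (bet_trans eac abc) eac).
Qed.

(** ** The kind of straight line-segments *)

Record segment := Segment { seg1 : E; seg2 : E; seg_neq : seg1 <> seg2 }.

Definition seg_cong (s t : segment) : Prop :=
  cong (seg1 s) (seg2 s) (seg1 t) (seg2 t).

Definition seg_class : Type := quot seg_cong.

Definition mkseg a b (ab : a <> b) : seg_class := class seg_cong (Segment ab).

Lemma mkseg_eqP a b c d (ab : a <> b) (cd : c <> d) :
  mkseg ab = mkseg cd <-> cong a b c d.
Proof.
apply: class_eqP => [s|s t|s t r]; first exact: cong_refl.
- exact: cong_sym.
- exact: cong_trans.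
Qed.

Lemma msegP (X : seg_class) : exists a b (ab : a <> b), X = mkseg ab.
Proof. by have [[a b ab] ->] := quotP X; exists a, b, ab. Qed.

(* Z is obtained by laying a segment of class X and one of class Y end to
   end. *)
Definition is_seg_sum (X Y Z : seg_class) : Prop :=
  exists a b c (ab : a <> b) (bc : b <> c) (ac : a <> c),
  [/\ bet a b c, X = mkseg ab, Y = mkseg bc & Z = mkseg ac].

Lemma is_seg_sum_exists X Y : exists Z, is_seg_sum X Y Z.
Proof.
have [a [b [ab ->]]] := msegP X; have [c [d [cd ->]]] := msegP Y.
have [e [abe be]] := segment_construction a b c d.
have nbe : b <> e.
  by move=> h; apply/cd/(@cong_identity E _ _ b)/cong_sym; rewrite {2}h.
have nae : a <> e by move=> h; rewrite -h in abe; exact/ab/bet_identity.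
exists (mkseg nae), a, b, e, ab, nbe, nae; split=> //.
exact/mkseg_eqP/cong_sym.
Qed.

Lemma is_seg_sum_uniq X Y Z Z' :
  is_seg_sum X Y Z -> is_seg_sum X Y Z' -> Z = Z'.
Proof.
move=> [a [b [c [ab [bc [ac [abc -> -> ->]]]]]]].
move=> [a' [b' [c' [ab' [bc' [ac' [abc']]]]]]].
move=> /mkseg_eqP h /mkseg_eqP k ->.
exact/mkseg_eqP/(cong_add abc abc').
Qed.

Definition seg_add (X Y : seg_class) : seg_class :=
  proj1_sig (cid (is_seg_sum_exists X Y)).

Lemma seg_addP X Y Z : seg_add X Y = Z <-> is_seg_sum X Y Z.
Proof.
rewrite /seg_add; case: cid => T /= XYT; split=> [<- //|].
exact: is_seg_sum_uniq.
Qed.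

Lemma seg_add_mk a b c (ab : a <> b) (bc : b <> c) (ac : a <> c) :
  bet a b c -> seg_add (mkseg ab) (mkseg bc) = mkseg ac.
Proof. by move=> abc; apply/seg_addP; exists a, b, c, ab, bc, ac. Qed.

Lemma bet_neq a b c : a <> b -> @bet E a b c -> a <> c.
Proof. by move=> ab abc h; rewrite -h in abc; apply/ab/bet_identity. Qed.

Lemma seg_ext a b (ab : a <> b) (Y : seg_class) :
  exists c (bc : b <> c), bet a b c /\ Y = mkseg bc.
Proof.
have [c [d [cd ->]]] := msegP Y.
have [e [abe be]] := segment_construction a b c d.
have nbe : b <> e.
  by move=> h; apply/cd/(@cong_identity E _ _ b)/cong_sym; rewrite {2}h.
by exists e, nbe; split=> //; apply/mkseg_eqP/cong_sym.
Qed.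

Lemma mkseg_swap a b (ab : a <> b) (ba : b <> a) : mkseg ab = mkseg ba.
Proof. exact/mkseg_eqP/cong_swap. Qed.

Lemma seg_addC : commutative seg_add.
Proof.
move=> X Y; have [a [b [ab ->]]] := msegP X.
have [c [bc [abc ->]]] := seg_ext ab Y.
have ac := bet_neq ab abc.
rewrite (seg_add_mk ab bc ac abc) (mkseg_swap ab (nesym ab)).
rewrite (mkseg_swap bc (nesym bc)) (mkseg_swap ac (nesym ac)).
by rewrite (seg_add_mk _ _ (nesym ac) (bet_sym abc)).
Qed.

Lemma seg_addA : associative seg_add.
Proof.
move=> X Y Z; have [a [b [ab ->]]] := msegP X.
have [c [bc [abc ->]]] := seg_ext ab Y.
have ac := bet_neq ab abc.
have [d [cd [acd ->]]] := seg_ext ac Z.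
have bcd : bet b c d by exact/bet_sym/(bet_trans (bet_sym acd) (bet_sym abc)).
have abd : bet a b d.
  exact: bet_sym (bet_outer (nesym bc) (bet_sym bcd) (bet_sym abc)).
have ad := bet_neq ac acd; have bd := bet_neq bc bcd.
by rewrite (seg_add_mk bc cd bd) // (seg_add_mk ab bd ad) //
  (seg_add_mk ab bc ac) // (seg_add_mk ac cd ad).
Qed.

Definition seg_lt (X Y : seg_class) : Prop := exists Z, Y = seg_add X Z.

Definition seg_minus (X Y Z : seg_class) : Prop := X = seg_add Y Z.

Lemma seg_lt_irrefl X : ~ seg_lt X X.
Proof.
move=> [Z]; have [a [b [ab ->]]] := msegP X.
have [c [bc [abc ->]]] := seg_ext ab Z.
rewrite (seg_add_mk ab bc (bet_neq ab abc) abc) => /mkseg_eqP h.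
exact/bc/(bet_lt_ncong abc).
Qed.

Lemma seg_lt_mk a b c (ab : a <> b) (ac : a <> c) :
  bet a b c -> b <> c -> seg_lt (mkseg ab) (mkseg ac).
Proof.
by move=> abc bc; exists (mkseg bc); rewrite (seg_add_mk ab bc ac abc).
Qed.

Lemma seg_trichotomy X Y : [\/ seg_lt X Y, X = Y | seg_lt Y X].
Proof.
have [a [b [ab ->]]] := msegP X.
have [e [ae [bae _]]] := seg_ext (nesym ab) X.
have eab := bet_sym bae; have ea := nesym ae.
have [f [af [eaf ->]]] := seg_ext ea Y.
have [bf|bf] := pselect (b = f).
  by apply: Or32; apply/mkseg_eqP; rewrite bf; apply: cong_refl.
have [ebf|efb] := bet_connect eab eaf ea.
  apply: Or31; apply: seg_lt_mk => //.
  exact/bet_sym/(bet_trans (bet_sym ebf) bae).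
apply: Or33; apply: seg_lt_mk; last exact: nesym.
exact/bet_sym/(bet_trans (bet_sym efb) (bet_sym eaf)).
Qed.

Lemma seg_archimedean X Y :
  exists n, (0 < n)%N /\ seg_lt Y (multiple seg_add n X).
Proof.
have [c [d [cd ->]]] := msegP X; have [a [b [ab ->]]] := msegP Y.
have [n [p [n0 p0 pcong pbet [abp bp]]]] := archimedean ab cd.
have pneq i : (i < n)%N -> p i <> p i.+1.
  move=> ni h; apply/cd/(@cong_identity E _ _ (p i))/cong_sym.
  by rewrite {2}h; apply: pcong.
have hn k : (k < n)%N -> exists ak : a <> p k.+1,
    multiple seg_add k.+1 (mkseg cd) = mkseg ak /\
    forall q, p k <> p k.+1 -> bet (p k) (p k.+1) q -> bet a (p k.+1) q.
  elim: k => [|k IH] kn.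
    have := pneq 0 n0; rewrite p0 => a1; exists a1; split=> //.
    by apply/mkseg_eqP/cong_sym; rewrite -p0; apply: pcong.
  have [ak [e hq]] := IH (ltnW kn).
  have akk : bet a (p k.+1) (p k.+2).
    by apply: hq; [apply/pneq/ltnW|apply: pbet].
  exists (bet_neq ak akk); split; last by move=> q nk; apply: bet_outer.
  rewrite /multiple /= in e *; rewrite e.
  rewrite -(seg_add_mk ak (pneq _ kn)) //; congr seg_add.
  exact/mkseg_eqP/cong_sym/pcong.
exists n; split=> //.
have [|an [e _]] := hn n.-1; first by rewrite prednK.
move: an e; rewrite (prednK n0) => an ->.
exact: seg_lt_mk.
Qed.

Definition K1 : kind :=
  @Kind seg_class seg_add seg_lt seg_minus seg_addA seg_addC
    (fun _ _ => iff_refl _) seg_lt_irrefl seg_trichotomy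
    (fun _ _ _ => iff_refl _) seg_archimedean.

End Geometry.

(* Main.v *)
(** The pair (v, w) is determined up to [eqE] by the fractions n/m with
    m v > n w, and these form an initial segment without greatest element; hence
    [ltE] is a linear order across kinds in which the rational ratios are dense.
    For a fixed segment t, the segments x with (x, t) > (v, w) form an upper set
    of K1, and the point c that continuity assigns to the corresponding cut of a
    line satisfies (c, t) = (v, w): otherwise c could be moved slightly without
    crossing the cut, since K1 has arbitrarily small segments (by Pasch). By
    density of the rational ratios, the class of (c, t) is the supremum. *)

From mathcomp Require Import all_boot.
From mathcomp Require Import boolp classical_sets.
Require Import Defs.

Set Implicit Arguments.
Unset Strict Implicit.
Unset Printing Implicit Defensive.

Local Open Scope classical_set_scope.

(** * Arithmetic in a kind of magnitude *)

Section KindTheory.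
Variable K : kind.
Implicit Types (x y z t : K) (m n k : nat).

Local Notation "x +k y" := (@kind_add K x y) (at level 50, left associativity).
Local Notation "x <k y" := (@kind_lt K x y) (at level 70).
Local Notation "x <=k y" := (@kind_le K x y) (at level 70).

Lemma kind_lt_addr x y : x <k (x +k y).
Proof. by apply/kind_ltE; exists y. Qed.

Lemma kind_lt_trans y x z : x <k y -> y <k z -> x <k z.
Proof.
move=> /kind_ltE[a ->] /kind_ltE[b ->]; apply/kind_ltE; exists (a +k b).
by rewrite kind_addA.
Qed.

Lemma kind_lt_asym x y : x <k y -> ~ y <k x.
Proof. by move=> xy yx; apply: (@kind_lt_irrefl K x); apply: kind_lt_trans yx. Qed.

Lemma kind_leNgt x y : x <=k y <-> ~ y <k x.
Proof.
split=> [[xy|->]|yx]; [exact: kind_lt_asym|exact: kind_lt_irrefl|].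
by case: (kind_trichotomy x y) => h //; [left|right].
Qed.

Lemma kind_ltNge x y : x <k y <-> ~ y <=k x.
Proof. by rewrite kind_leNgt notK. Qed.

Lemma kind_le_lt_trans y x z : x <=k y -> y <k z -> x <k z.
Proof. by move=> [xy|->] //; apply: kind_lt_trans. Qed.

Lemma kind_lt_le_trans y x z : x <k y -> y <=k z -> x <k z.
Proof. by move=> xy [yz|<-] //; apply: kind_lt_trans yz. Qed.

Lemma kind_le_trans y x z : x <=k y -> y <=k z -> x <=k z.
Proof. by move=> [xy|->] // yz; left; apply: kind_lt_le_trans yz. Qed.

Lemma kind_lt_add2r z x y : x <k y -> (x +k z) <k (y +k z).
Proof.
move=> /kind_ltE[a ->]; rewrite -kind_addA (kind_addC a) kind_addA.
exact: kind_lt_addr.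
Qed.

Lemma kind_lt_add2l z x y : x <k y -> (z +k x) <k (z +k y).
Proof. by rewrite !(kind_addC z); apply: kind_lt_add2r. Qed.

Lemma nmulS n x : (0 < n)%N -> nmul n.+1 x = nmul n x +k x.
Proof. by case: n. Qed.

Lemma nmulD n x y : nmul n (x +k y) = nmul n x +k nmul n y.
Proof.
case: n => // n; elim: n => // n IH.
rewrite ![nmul n.+2 _]nmulS // IH -!kind_addA; congr kind_add.
by rewrite kind_addC -kind_addA (kind_addC y).
Qed.

Lemma nmul_addn m n x : (0 < m)%N -> (0 < n)%N ->
  nmul (m + n) x = nmul m x +k nmul n x.
Proof.
case: n => // n m0 _; elim: n => [|n IH]; first by rewrite addn1 nmulS.
by rewrite addnS nmulS ?addn_gt0 ?m0 // IH [nmul n.+2 _]nmulS // kind_addA.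
Qed.

Lemma nmul_muln m n x : (0 < m)%N -> (0 < n)%N ->
  nmul (m * n) x = nmul m (nmul n x).
Proof.
case: m => // m _ n0.
elim: m => [|m IH]; first by rewrite mul1n.
by rewrite mulSn addnC nmul_addn ?muln_gt0 // IH [nmul m.+2 _]nmulS.
Qed.

Lemma nmul_lt n x y : x <k y -> nmul n x <k nmul n y.
Proof. by move=> /kind_ltE[z ->]; rewrite nmulD; apply: kind_lt_addr. Qed.

Lemma nmul_le n x y : x <=k y -> nmul n x <=k nmul n y.
Proof. by move=> [/(nmul_lt n) h|->]; [left|right]. Qed.

Lemma nmul_ltP n x y : nmul n x <k nmul n y <-> x <k y.
Proof.
split=> [|/nmul_lt //]; rewrite !kind_ltNge => h yx; exact/h/nmul_le.
Qed.

Lemma nmul_ltn m n x : (0 < m)%N -> (m < n)%N -> nmul m x <k nmul n x.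
Proof.
move=> m0 mn; rewrite -(subnKC (ltnW mn)) nmul_addn ?subn_gt0 //.
exact: kind_lt_addr.
Qed.

Lemma nmul_len m n x : (0 < m)%N -> (m <= n)%N -> nmul m x <=k nmul n x.
Proof.
by move=> m0; rewrite leq_eqVlt => /orP[/eqP->|/(nmul_ltn x m0) h];
  [right|left].
Qed.

Lemma nmul_ltnP m n x : (0 < m)%N -> (0 < n)%N ->
  nmul m x <k nmul n x <-> (m < n)%N.
Proof.
move=> m0 n0; split=> [|/nmul_ltn]; last exact.
by rewrite ltnNge kind_ltNge => h; apply/negP => nm; exact/h/nmul_len.
Qed.

(** By the Archimedean axiom, [k] copies of the excess of [m x] over [n y] exceed [y], which leaves
    room for one more [y]. *)
Lemma kind_lt_refine m n x y : (0 < m)%N -> (0 < n)%N ->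
  nmul n y <k nmul m x ->
  exists2 k, (0 < k)%N & nmul (k * n).+1 y <k nmul (k * m) x.
Proof.
move=> m0 n0 /kind_ltE[z e]; have [k [k0 h]] := kind_archimedean z y.
exists k => //; rewrite nmulS ?muln_gt0 ?k0 // !nmul_muln // e nmulD.
exact: kind_lt_add2l.
Qed.

(** * Arbitrarily small magnitudes *)

Section NoLeast.
Hypothesis no_least : forall x, exists y, y <k x.

(** If [x = y + z], twice the smaller of [y] and [z] is at most [x]. *)
Lemma exists_half x : exists y, nmul 2 y <=k x.
Proof.
have [y /kind_ltE[z ->]] := no_least x.
case: (kind_trichotomy y z) => [yz|->|zy].
- by exists y; left; apply: kind_lt_add2l.
- by exists z; right.
- by exists z; left; apply: kind_lt_add2r.
Qed.

Lemma exists_small n x : exists y, nmul n y <k x.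
Proof.
(* The non-strict bound on [n + 1] copies survives halving, as [n + 2 <= 2 (n + 1)]; dropping one
   copy makes it strict. *)
suff [y h] : exists y, nmul n.+1 y <=k x.
  case: n h => [|n] h; last first.
    by exists y; apply: kind_lt_le_trans h; apply: nmul_ltn.
  (* [nmul 0 z] is [z] by the form of [multiple]. *)
  by have [z zx] := no_least x; exists z.
elim: n => [|n [y h]]; first by exists x; right.
have [z hz] := exists_half y; exists z.
apply: kind_le_trans h; apply: kind_le_trans (nmul_le n.+1 hz).
rewrite -nmul_muln //; apply: nmul_len => //.
by rewrite muln2 -addnn addSnnS leq_addl.
Qed.

End NoLeast.
End KindTheory.

(** * Comparison of ratios across kinds *)

Section RatioTheory.
Variables K K' : kind.
Implicit Types (p : K * K) (q : K' * K').

(** Cross-multiplying the two witnesses gives [m n' < m' n] in [K] and the opposite in [K']. *)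
Lemma ltE_asym p q : ltE p q -> ~ ltE q p.
Proof.
move=> [m [n [m0 n0 gt le]]] [m' [n' [m'0 n'0 gt' le']]].
have h1 : kind_lt (nmul (m * n') p.2) (nmul (m' * n) p.2).
  apply: kind_lt_le_trans (_ : kind_lt _ (nmul (m' * m) p.1)) _.
    by rewrite (mulnC m') !nmul_muln //; apply: nmul_lt.
  by rewrite !nmul_muln //; apply: nmul_le.
have h2 : kind_lt (nmul (m' * n) q.2) (nmul (m * n') q.2).
  apply: kind_lt_le_trans (_ : kind_lt _ (nmul (m * m') q.1)) _.
    by rewrite (mulnC m) !nmul_muln //; apply: nmul_lt.
  by rewrite !nmul_muln //; apply: nmul_le.
move/nmul_ltnP: h1; rewrite !muln_gt0 m0 n0 m'0 n'0 => /(_ isT isT) h1.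
move/nmul_ltnP: h2; rewrite !muln_gt0 m0 n0 m'0 n'0 => /(_ isT isT) h2.
by have := ltn_trans h1 h2; rewrite ltnn.
Qed.

Lemma nltE_gt p q : ~ ltE p q -> forall m n, (0 < m)%N -> (0 < n)%N ->
  kind_lt (nmul n q.2) (nmul m q.1) -> kind_lt (nmul n p.2) (nmul m p.1).
Proof.
move=> npq m n m0 n0 h; apply/kind_ltNge => le.
by apply: npq; exists m, n.
Qed.

Lemma nltE_lt p q : ~ ltE p q -> forall m n, (0 < m)%N -> (0 < n)%N ->
  kind_lt (nmul m p.1) (nmul n p.2) -> kind_lt (nmul m q.1) (nmul n q.2).
Proof.
move=> npq m n m0 n0 h; apply/kind_ltNge => le.
(* One more [q.1] makes [k n q.2 <= k m q.1] strict, while [(k m + 1) p.1] stays below [k n p.2];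
   this would put [p] below [q]. *)
have [k k0 hk] := kind_lt_refine n0 m0 h.
have gt : kind_lt (nmul (k * n) q.2) (nmul (k * m).+1 q.1).
  rewrite nmulS ?muln_gt0 ?k0 // !nmul_muln //.
  by apply: kind_le_lt_trans (nmul_le k le) _; apply: kind_lt_addr.
by apply: npq; exists (k * m).+1, (k * n)%N; split=> //;
  [rewrite muln_gt0 k0|left].
Qed.

End RatioTheory.

(** Makes [ltE] trichotomous across kinds. The strict clauses transfer by the two preceding lemmas,
    the equality clause by trichotomy inside each kind. *)
Lemma eqE_nltE (K K' : kind) (p : K * K) (q : K' * K') :
  eqE p q <-> ~ ltE p q /\ ~ ltE q p.
Proof.
split=> [pq|[npq nqp] m n m0 n0].
  have irr (L : kind) (r : L * L) : ~ ltE r r.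
    by move=> h; exact: (ltE_asym h h).
  split=> h; first exact/(irr _ q)/(ltE_eqE pq (eqE_refl q)).
  by apply: (irr _ q); apply: ltE_eqE (eqE_refl q) pq h.
have hgt : kind_gt (nmul m p.1) (nmul n p.2) <->
           kind_gt (nmul m q.1) (nmul n q.2).
  by split; apply: nltE_gt.
have hlt : kind_lt (nmul m p.1) (nmul n p.2) <->
           kind_lt (nmul m q.1) (nmul n q.2).
  by split; apply: nltE_lt.
split=> //; split=> e.
- case: (kind_trichotomy (nmul m q.1) (nmul n q.2)) => //.
    by move/hlt; rewrite e => /kind_lt_irrefl.
  by move/hgt; rewrite /kind_gt e => /kind_lt_irrefl.
- case: (kind_trichotomy (nmul m p.1) (nmul n p.2)) => //.
    by move/hlt; rewrite e => /kind_lt_irrefl.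
  by move/hgt; rewrite /kind_gt e => /kind_lt_irrefl.
Qed.

Lemma nltE_eqE_lt (K K' : kind) (p : K * K) (q : K' * K') :
  ~ ltE p q -> eqE q p \/ ltE q p.
Proof.
move=> npq; have [qp|nqp] := pselect (ltE q p); first by right.
by left; apply/eqE_nltE.
Qed.

(* If [m q.1 > n q.2] and [m p.1 <= n p.2], then [(k n + 1) / (k m)] separates p
   from q for large [k]. *)
Lemma ltE_rational_between (K K' U : kind) (s : U) (p : K * K) (q : K' * K') :
  ltE p q -> exists i j, [/\ (0 < i)%N, (0 < j)%N,
    ltE p (nmul i s, nmul j s) & ltE (nmul i s, nmul j s) q].
Proof.
move=> [m [n [m0 n0 gt le]]].
have [k k0 hk] := kind_lt_refine m0 n0 gt.
have km0 : (0 < k * m)%N by rewrite muln_gt0 k0.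
exists (k * n).+1, (k * m)%N; split=> //.
  exists m, n; split=> //; rewrite /kind_gt /= -!nmul_muln //.
  apply/nmul_ltnP; rewrite ?muln_gt0 ?m0 ?n0 ?k0 //.
  by rewrite mulnS mulnCA (mulnCA m) (mulnC n) -[X in (X < _)%N]add0n ltn_add2r.
(* Both sides are the same multiple of [s]: the equality case of the non-strict half of [gtE]. *)
exists (k * m)%N, (k * n).+1; split=> //; right.
by rewrite /= -!nmul_muln // mulnC.
Qed.

(** * Suprema of sets of rational ratios *)

Section Supremum.
Variables (U : kind) (s : U).

Lemma ratio_le_class (p q : U * U) :
  ratio_le (ratio_class p) (ratio_class q) <-> ~ ltE q p.
Proof.
split=> [[/ratio_lt_classP/ltE_asym //|/ratio_class_eqP/eqE_nltE[] //]|].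
by move=> /nltE_eqE_lt[/ratio_class_eqP|/ratio_lt_classP]; [right|left].
Qed.

Lemma is_sup_rationals_below (K : kind) (v w : K) (r t : U) :
  eqE (v, w) (r, t) -> is_sup (rationals_below s v w) (ratio_class (r, t)).
Proof.
move=> e; split=> [_ [i [j [i0 j0 lt ->]]]|Z ub].
  apply/ratio_le_class/ltE_asym.
  exact: ltE_eqE (eqE_refl _) e lt.
have [p Zp] := quotP Z; rewrite {}Zp in ub *; apply/ratio_le_class => lt.
have [i [j [i0 j0 lt1 lt2]]] := ltE_rational_between s lt.
have /ub : rationals_below s v w (ratio_class (nmul i s, nmul j s)).
  by exists i, j; split=> //; apply: ltE_eqE (eqE_refl _) (eqE_sym e) lt2.
by move/ratio_le_class; apply.
Qed.

Lemma is_sup_uniq (S : set (ratio U)) (X Y : ratio U) :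
  is_sup S X -> is_sup S Y -> X = Y.
Proof.
have [p ->] := quotP X; have [q ->] := quotP Y.
move=> [ubp leastp] [ubq leastq].
have /ratio_le_class pq := leastp _ ubq.
have /ratio_le_class qp := leastq _ ubp.
exact/ratio_class_eqP/eqE_nltE.
Qed.

(** The supremum exists, so the default value in [Ratio] is never taken. *)
Lemma Ratio_eqE (K : kind) (v w : K) (r t : U) :
  eqE (v, w) (r, t) -> Ratio s v w = ratio_class (r, t).
Proof.
move=> /is_sup_rationals_below h; rewrite /Ratio; case: xgetP => [X _ hX|/(_ _ h)//].
exact: is_sup_uniq h.
Qed.

End Supremum.

(** * Universality of a kind with small magnitudes and cuts *)

Section Universal.
Variable U : kind.
Hypothesis no_least : forall x : U, exists y, kind_lt y x.
(** Whether [c] lies in [S] is left open, so a least element of [S] and a greatest one of its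
    complement both qualify. *)
Hypothesis cut : forall S : set U, S !=set0 -> ~` S !=set0 ->
  (forall x y, S x -> kind_lt x y -> S y) ->
  exists c, (forall d, kind_lt d c -> ~ S d) /\ (forall d, kind_lt c d -> S d).

Lemma exists_fourth_proportional (K : kind) (v w : K) (t : U) :
  exists c, eqE (v, w) (c, t).
Proof.
have [] := @cut [set x | ltE (v, w) (x, t)].
(* Since [v < n w], the ratio of [(n + 1) t] to [t] exceeds that of [v] to [w]. *)
- have [n [n0 h]] := kind_archimedean w v.
  by exists (nmul n.+1 t), 1, n; split=> //; [apply: nmul_ltn|left].
- have [n [n0 h]] := kind_archimedean v w; have [x xt] := exists_small no_least n t.
  exists x; apply: ltE_asym; exists n, 1; split=> //; by left.
- move=> x y [m [n [m0 n0 gt le]]] xy; exists m, n; split=> //.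
  by apply: kind_lt_trans gt _; apply: nmul_lt.
move=> c [below above]; exists c; apply/eqE_nltE; split=> -[m [n [m0 n0 gt le]]].
(* Shrinking [c] by some [x] with [m x < z] gives [d < c] with [m d > n t], so [d] is still in the
   upper set. *)
- have /kind_ltE[z e] : kind_lt (nmul n t) (nmul m c) by [].
  have [x xz] := exists_small no_least m z.
  have /kind_ltE[d cd] : kind_lt x c.
    apply/(nmul_ltP m); apply: kind_lt_trans xz _.
    by rewrite e kind_addC; apply: kind_lt_addr.
  apply: (below d); first by rewrite cd kind_addC; apply: kind_lt_addr.
  exists m, n; split=> //; rewrite /kind_gt /=.
  apply/kind_ltNge => /= dle; apply: (@kind_lt_irrefl _ (nmul m c)).
  rewrite {1}cd nmulD e (kind_addC _ z).
  case: dle => [lt|->]; last exact: kind_lt_add2r.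
  exact: kind_lt_trans (kind_lt_add2r _ xz) (kind_lt_add2l _ lt).
(* If [k m x < t], then [k m (c + x) < (k n + 1) t], so [c + x] is not yet in the upper set. *)
- have [k k0 hk] := kind_lt_refine m0 n0 gt.
  have km0 : (0 < k * m)%N by rewrite muln_gt0 k0.
  have [x xt] := exists_small no_least (k * m) t.
  have := above _ (kind_lt_addr c x); apply: ltE_asym.
  exists (k * m)%N, (k * n).+1; split=> //; left.
  rewrite /= nmulD nmulS ?muln_gt0 ?k0 //.
  have := nmul_le k le; rewrite /= -!nmul_muln // => h.
  case: h => [lt|->]; last exact: kind_lt_add2l.
  exact: kind_lt_trans (kind_lt_add2r _ lt) (kind_lt_add2l _ xt).
Qed.

End Universal.

(** * Straight lines and segments *)

Section Geometry.
Variable E : euclidean_geometry.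
Implicit Types (a b c d p q x y z u t : E).

Lemma bet_exchange a b c d : @bet E a b c -> bet a c d -> bet b c d.
Proof. by move=> abc acd; apply/bet_sym/(bet_trans (bet_sym acd))/bet_sym. Qed.

Lemma bet_left a b : @bet E a a b.
Proof. exact/bet_sym/bet_refl. Qed.

Lemma exists_neq a : exists b, a <> b.
Proof.
have [x [y [z [h _ _]]]] := lower_dim E.
have xy : x <> y by move=> xy; apply: h; rewrite xy; apply: bet_left.
by have [xa|] := pselect (a = x); [exists y; rewrite xa|exists x].
Qed.

Lemma extend a b : exists c, @bet E a b c /\ b <> c.
Proof.
have [d ad] := exists_neq a; have [c [abc e]] := segment_construction a b a d.
exists c; split=> // bc; apply: ad; apply: (@cong_identity E _ _ b).
by apply: cong_sym; rewrite {2}bc.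
Qed.

Lemma bet_exchange2 a b c d : @bet E a b c -> bet a c d -> bet a b d.
Proof.
move=> abc acd; have [->//|bc] := pselect (b = c).
apply/bet_sym; apply: bet_outer (nesym bc) _ (bet_sym abc).
exact/bet_sym/(bet_exchange abc acd).
Qed.

(** Prolonging [da] beyond [a] to [e] puts [b] and [c] on one ray from [e] through [a], where
    [bet_connect] applies. *)
Lemma bet_connect_inner a b c d : @bet E a b d -> bet a c d ->
  bet a b c \/ bet a c b.
Proof.
move=> abd acd; have [e [dae ae]] := extend d a.
have eab := bet_trans (bet_sym dae) abd.
have eac := bet_trans (bet_sym dae) acd.
have [h|h] := bet_connect eab eac (nesym ae).
  by left; apply: bet_exchange eab h.
by right; apply: bet_exchange eac h.
Qed.

(** * Collinearity and points inside a segment *)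

Definition collinear a b c : Prop :=
  [\/ @bet E a b c, bet b c a | bet c a b].

Lemma collinear_rot a b c : collinear a b c -> collinear b c a.
Proof. by case=> h; [apply: Or33|apply: Or31|apply: Or32]. Qed.

Lemma collinear_swap a b c : collinear a b c -> collinear b a c.
Proof. by case=> /bet_sym h; [apply: Or33|apply: Or32|apply: Or31]. Qed.

Lemma collinear_trans p q a b : p <> q ->
  collinear p q a -> collinear p q b -> collinear p a b.
Proof.
move=> pq.
have case12 x y : bet p q x -> bet q y p -> collinear p x y.
  by move=> pqx qyp; apply/Or32/bet_sym/(bet_exchange2 (bet_sym qyp) pqx).
have case13 x y : bet p q x -> bet y p q -> collinear p x y.
  move=> pqx ypq; apply: Or33.
  exact: bet_exchange2 ypq (bet_outer pq ypq pqx).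
have case23 x y : bet q x p -> bet y p q -> collinear p x y.
  by move=> qxp ypq; apply: Or33; apply: bet_trans ypq (bet_sym qxp).
have sym x y : collinear p x y -> collinear p y x.
  by move=> /collinear_rot/collinear_swap/collinear_rot/collinear_rot.
(* Of the nine relative positions, only those where [a] and [b] lie in the same part of the line
   remain. *)
move=> [ha|ha|ha] [hb|hb|hb]; try by [exact: case12|exact: case13|
  exact: case23|exact/sym/case12|exact/sym/case13|exact/sym/case23].
- by have [h|h] := bet_connect ha hb pq; [apply: Or31|apply/Or32/bet_sym].
- have [h|h] := bet_connect_inner (bet_sym ha) (bet_sym hb); first exact: Or31.
  exact/Or32/bet_sym.
- have [h|h] := bet_connect (bet_sym ha) (bet_sym hb) (nesym pq).
    exact/Or31/(bet_exchange (bet_sym ha) h).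
  exact/Or32/bet_sym/(bet_exchange (bet_sym hb) h).
Qed.

(* Extend [a t] to [u] and [b u] to [z]; by outer Pasch the line [z t] meets the
   segment [a b]. *)
Lemma exists_between a b t : ~ collinear a b t ->
  exists c, [/\ @bet E a c b, c <> a & c <> b].
Proof.
move=> ncol.
have at_ : a <> t.
  by move=> at_; apply: ncol; rewrite at_; apply/Or32/bet_refl.
have [u [atu tu]] := extend a t; have [z [buz uz]] := extend b u.
have [v [avb ztv]] := pasch atu buz.
have Catu : collinear a t u by apply: Or31.
have Cbuz : collinear b u z by apply: Or31.
exists v; split=> // [va|vb].
(* If [v = a], then [z] lies on the line [au], and [b] lies on [uz], so all these points are
   collinear. *)
- rewrite {}va in ztv.
  have Cauz : collinear a u z.
    by apply: collinear_trans at_ Catu _; apply/collinear_swap/collinear_rot/Or31.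
  have Cuab := collinear_trans uz (collinear_rot Cauz) (collinear_rot Cbuz).
  apply: ncol; apply: (collinear_trans (bet_neq at_ atu)).
    exact: collinear_swap Cuab.
  exact/collinear_swap/collinear_rot/collinear_rot.
- rewrite {}vb in ztv.
  have bz : b <> z.
    by move=> bz; rewrite -bz in buz uz; exact/uz/esym/(bet_identity buz).
  have Cbtu : collinear b t u.
    apply: (collinear_trans bz); first exact/collinear_swap/Or32/bet_sym.
    exact/collinear_swap/Or32.
  apply/ncol/collinear_rot/(collinear_trans tu (collinear_rot Catu)).
  exact: collinear_rot Cbtu.
Qed.

Lemma K1_no_least (X : K1 E) : exists Y : K1 E, kind_lt Y X.
Proof.
have [x [y [z [n1 n2 n3]]]] := lower_dim E.
have ncol : ~ collinear x y z.
  by move=> [//|//|//].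
have yx : y <> x by move=> yx; apply: ncol; rewrite yx; apply/Or31/bet_left.
(* [X] is laid off on the line [yx], so that [z] is off its line. *)
have [b [xb [yxb ->]]] := seg_ext yx X.
have [|c [xcb cx cb]] := @exists_between x b z.
  move=> h; apply: ncol; apply: collinear_trans xb _ h.
  exact/collinear_rot/Or31.
by exists (mkseg (nesym cx)); apply: seg_lt_mk.
Qed.

Lemma seg_le_mk a b c (ab : a <> b) (ac : a <> c) : bet a b c ->
  @kind_le (K1 E) (mkseg ab) (mkseg ac).
Proof.
move=> abc; have [bc|bc] := pselect (b = c); last by left; apply: seg_lt_mk.
by right; apply/mkseg_eqP; rewrite bc; apply: cong_refl.
Qed.

Lemma line_lt_ray z u x y : z <> u -> @bet E z u x -> line_lt z u x y ->
  bet u x y.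
Proof.
move=> zu zux [_ [a [b [[azu aub] [axy ayb]]]]].
have azx := bet_exchange2 azu (bet_outer zu azu zux).
exact: bet_exchange zux (bet_exchange azx axy).
Qed.

(** * From cuts of a line to cuts of segment classes *)

Hypothesis cont : continuity_axiom E.

Lemma K1_cut (S : set (K1 E)) : S !=set0 -> ~` S !=set0 ->
  (forall X Y, S X -> kind_lt X Y -> S Y) ->
  exists C, (forall D, kind_lt D C -> ~ S D) /\ (forall D, kind_lt C D -> S D).
Proof.
move=> [X SX] [Y nSY] up_closed.
have [z [u [zu _]]] := msegP X.
(* Classes are represented by points beyond [u], as ends of segments laid off from [u]; [z] only
   fixes the direction. [A] thus contains [u] and everything before it. *)
pose B : set E := [set x | bet z u x /\ exists ux : u <> x, S (mkseg ux)].
pose A : set E := line z u `\` B.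
have [y [uy [zuy eY]]] := seg_ext zu Y; rewrite {}eY in nSY.
have [x [ux [zux eX]]] := seg_ext zu X; rewrite {}eX in SX.
have nB w (uw : u <> w) : ~ S (mkseg uw) -> ~ B w.
  by move=> nS [_ [uw' Sw]]; apply: nS; rewrite (Prop_irrelevance uw uw').
have Ay : A y by split; [apply: Or31|apply: nB nSY].
have cut : line_cut z u A B.
  split.
  - by exists y.
  - by exists x; split=> //; exists ux.
  - rewrite setDKU // => w [zuw _]; exact: Or31.
  - exact: setDKI.
  - move=> p q [lp nBp] Bq; have [zuq [uq Sq]] := Bq.
    split; first by move=> pq; apply: nBp; rewrite pq.
    have line_lt_of : bet z p q -> exists a b,
        ordered_between a z u b /\ ordered_between a p q b.
      move=> zpq; exists z, q; split; split=> //; first exact: bet_left.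
      exact: bet_refl.
    case: lp => [zup|upz|pzu].
    (* If [q] came before [p], upward closure of [S] would put [p] in [B]. *)
    + have [//|zqp] := bet_connect zup zuq zu.
      have uqp := bet_exchange zuq zqp; have up := bet_neq uq uqp.
      case: nBp; split=> //; exists up.
      case: (seg_le_mk uq up uqp) => [|<- //]; exact: up_closed.
    + exact/line_lt_of/(bet_exchange2 (bet_sym upz)).
    + exists p, q; split; split=> //; [exact: bet_outer pzu zuq|
        exact: bet_left|exact: bet_refl].
have [[g [Ag gA]]|[g [[zug [ug Sg]] gB]]] := cont zu cut.
(* [y] lies in [A] beyond [u] and does not come after [g]; so [g] is beyond [u] too and [ug] is
   nondegenerate. *)
- have [zug ug] : bet z u g /\ u <> g.
    case: (gA _ Ay) => [<- //|/(line_lt_ray zu zuy) uyg].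
    split; last exact: bet_neq uy uyg.
    exact: bet_exchange2 zuy (bet_outer uy zuy uyg).
  have nSg : ~ S (mkseg ug) by move=> Sg; case: Ag => _; apply; split=> //; exists ug.
  exists (mkseg ug); split=> [d dg Sd|d]; first exact/nSg/(up_closed _ _ Sd).
  have [w [uw [zuw ->]]] := seg_ext zu d => gw; apply: contrapT => nSw.
  have Aw : A w by split; [apply: Or31|apply: nB nSw].
  have uwg : bet u w g.
    by case: (gA _ Aw) => [->|/(line_lt_ray zu zuw) //]; apply: bet_refl.
  by case/kind_leNgt: (seg_le_mk uw ug uwg).
- exists (mkseg ug); split=> [d|d]; last exact: up_closed.
  have [w [uw [zuw ->]]] := seg_ext zu d => wg Sw.
  have Bw : B w by split=> //; exists uw.
  have ugw : bet u g w.
    by case: (gB _ Bw) => [->|/(line_lt_ray zu zug) //]; apply: bet_refl.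
  by case/kind_leNgt: (seg_le_mk ug uw ugw).
Qed.

End Geometry.

Theorem mainTheorem4 (E : euclidean_geometry) (cont : continuity_axiom E) :
  (* (a) *)
  (forall (s : K1 E) (K : kind) (v w : K),
     exists X : ratio (K1 E), is_sup (rationals_below s v w) X) /\
  (* (b) *)
  universal (K1 E) /\
  (* (c) *)
  (forall (s : K1 E) (K K' : kind) (v w : K) (v' w' : K'),
     eqE (v, w) (v', w') <-> Ratio s v w = Ratio s v' w').
Proof.
(* The second term can be prescribed: [s] in (a) and (c), an arbitrary segment in (b). *)
have fourth (K : kind) (v w : K) (t : K1 E) : exists r, eqE (v, w) (r, t).
  exact: exists_fourth_proportional (@K1_no_least E) (K1_cut cont) _ _ _ _.
split; last split=> [K v w|s K K' v w v' w'].
- move=> s K v w; have [r e] := fourth K v w s.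
  by exists (ratio_class (r, s)); apply: is_sup_rationals_below.
- have [a _] := lower_dim E; have [b ab] := exists_neq a.
  by have [r e] := fourth K v w (mkseg ab); exists r, (mkseg ab).
- have [r e] := fourth K v w s; have [r' e'] := fourth K' v' w' s.
  rewrite (Ratio_eqE s e) (Ratio_eqE s e') ratio_class_eqP.
  split=> h; first exact: eqE_trans (eqE_sym e) (eqE_trans h e').
  exact: eqE_trans e (eqE_trans h (eqE_sym e')).
Qed.
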